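(* Let $X, Y, Z$ be $\mathbb{F}$-adapted, integrable processes indexed by $t=0,1,\dots,T$ with $X_T=Y_T=Z_T$. Put $L=X\wedge Z$ and $U=Y\vee Z$, and define the process $V$ by $V_T:=Z_T$ and, for $t=0,1,\dots,T-1$, $$V_t:=\min\Big\{U_t,\ \max\big\{L_t,\ \mathbb{E}_{\mathbb{P}}(V_{t+1}\,|\,\mathcal{F}_t)\big\}\Big\}.$$ Then the inequality $$X_t\wedge Y_t\le V_t\le X_t\vee Y_t$$ holds (almost surely) for all $t=0,1,\dots,T$ if and only if the Dynkin game $\mathrm{GDG}_t(X,Y,Z)$ started at time $t$ and associated with the payoff $$R(\tau,\sigma)=\mathbf{1}_{\{\tau<\sigma\}}X_\tau+\mathbf{1}_{\{\sigma<\tau\}}Y_\sigma+\mathbf{1}_{\{\sigma=\tau\}}Z_\sigma$$ has a Nash equilibrium for all $t=0,1,\dots,T$.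
   Context: Discrete time with finite horizon $T$: $(\Omega,\mathcal{F},\mathbb{P})$ is a probability space with filtration $\mathbb{F}=(\mathcal{F}_t)_{t=0,1,\dots,T}$. $\mathcal{T}_{[t,T]}$ is the set of $\mathbb{F}$-stopping times with values in $\{t,t+1,\dots,T\}$. Inequalities between random variables are understood almost surely. The general Dynkin game $\mathrm{GDG}_t(X,Y,Z)$ is the zero-sum two-player game in which the max-player chooses $\tau_t\in\mathcal{T}_{[t,T]}$ to maximise, and the min-player chooses $\sigma_t\in\mathcal{T}_{[t,T]}$ to minimise, the conditional expectation $\mathbb{E}_{\mathbb{P}}(R(\tau_t,\sigma_t)\,|\,\mathcal{F}_t)$. No ordering of $X,Y,Z$ is assumed. A pair $(\tau_t^*,\sigma_t^* )\in\mathcal{T}_{[t,T]}\times\mathcal{T}_{[t,T]}$ is a Nash equilibrium if, for all $\tau_t,\sigma_t\in\mathcal{T}_{[t,T]}$, $$\mathbb{E}_{\mathbb{P}}(R(\tau_t^*,\sigma_t)\,|\,\mathcal{F}_t)\ge\mathbb{E}_{\mathbb{P}}(R(\tau_t^*,\sigma_t^* )\,|\,\mathcal{F}_t)\ge\mathbb{E}_{\mathbb{P}}(R(\tau_t,\sigma_t^* )\,|\,\mathcal{F}_t).$$ *)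

(* Defs.v *)
From HB Require Import structures.
From mathcomp Require Import all_boot all_order all_algebra.
From mathcomp Require Import all_classical all_reals all_analysis.
From mathcomp Require Import measurable_realfun.

Set Implicit Arguments.
Unset Strict Implicit.
Unset Printing Implicit Defensive.

Import Order.TTheory GRing.Theory Num.Theory.
Import numFieldNormedType.Exports.

Local Open Scope classical_set_scope.
Local Open Scope ring_scope.

Section conditional_expectation.
Context {d : measure_display} {Omega : measurableType d} {R : realType}.
Variable P : probability Omega R.
Implicit Types (G : set (set Omega)) (f g : Omega -> R).

Definition sub_sigma_algebra_of G :=
  sigma_algebra setT G /\ G `<=` measurable.

(* For a sigma-algebra G, the measurable sets of g_sigma_algebraType G are
   exactly the members of G (measurable_g_measurableTypeE). *)
Definition measurable_wrt G f :=
  measurable_fun [set: g_sigma_algebraType G] (f : g_sigma_algebraType G -> R).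

Definition is_condexp G f g :=
  [/\ measurable_wrt G g,
      P.-integrable setT (EFin \o g) &
      forall A, G A ->
        (\int[P]_(w in A) (g w)%:E = \int[P]_(w in A) (f w)%:E)%E].

(* A chosen version; the default value 0 is not used when f is integrable,
   see condexpP. *)
Definition condexp G f : Omega -> R := xget (cst 0) (is_condexp G f).

Lemma condexpP G f : sub_sigma_algebra_of G ->
  P.-integrable setT (EFin \o f) -> is_condexp G f (condexp G f).
Proof.
move=> [sG Gm] fi; apply: xgetPex.
pose S : measurableType G.-sigma := g_sigma_algebraType G.
have GE : G.-sigma.-measurable = G by exact: measurable_g_measurableTypeE.
pose phi : Omega -> S := idfun.
have mphi : measurable_fun setT phi by move=> _ B; rewrite GE setTI => /Gm.
pose phiM := MeasurableFun.Pack (MeasurableFun.Class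
  (isMeasurableFun.Build _ _ _ _ phi mphi)).
pose mu : probability S R := distribution P phiM.
pose nu0 : {charge set Omega -> \bar R} := induced_charge fi.
pose nu_ := [the charge _ _ of pushforward nu0 phiM].
pose nu : {charge set S -> \bar R} := nu_ mphi.
have numu : nu `<< mu.
  apply: dominates_pushforward => //; apply/null_content_dominatesP => A mA A0.
  apply: null_set_integral => //.
  exact: measurable_funS (measurable_int P fi).
pose g : Omega -> R := fun w => fine (Radon_Nikodym nu mu w).
have gE : EFin \o g = Radon_Nikodym nu mu.
  by apply/funext => w; rewrite /= fineK// Radon_Nikodym_fin_num.
have imu : mu.-integrable setT (EFin \o g).
  by rewrite gE; exact: Radon_Nikodym_integrable.
have mg := measurable_int mu imu.
have iP : P.-integrable setT (EFin \o g).
  apply/integrableP; split; first exact: measurableT_comp mg mphi.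
  case/integrableP : (imu) => _; rewrite ge0_integral_pushforward//.
  exact: measurable_int (integrable_abse imu).
exists g; split => //; first exact/measurable_EFinP.
move=> A GA; have mA : G.-sigma.-measurable A by rewrite GE.
transitivity (\int[mu]_(w in A) (EFin \o g) w)%E.
  rewrite integral_pushforward//.
  by apply: (integrableS measurableT) => //; exact: Gm.
by rewrite gE -Radon_Nikodym_integral.
Qed.

End conditional_expectation.

Section dynkin_game.
Context {d : measure_display} {Omega : measurableType d} {R : realType}.
Variables (P : probability Omega R) (T : nat) (F : nat -> set (set Omega)).
Implicit Types (t : nat) (X Y Z V : nat -> Omega -> R) (tau sigma : Omega -> nat).

(* Processes and filtrations are indexed by nat; only indices up to the
   horizon T are ever constrained. *)
Definition filtration :=
  (forall t, (t <= T)%N -> sub_sigma_algebra_of (F t)) /\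
  (forall s t, (s <= t <= T)%N -> F s `<=` F t).

Definition adapted X := forall t, (t <= T)%N -> measurable_wrt (F t) (X t).

Definition integrable_process X :=
  forall t, (t <= T)%N -> P.-integrable setT (EFin \o X t).

Definition stopping_time t tau :=
  (forall w, (t <= tau w <= T)%N) /\
  (forall s, (s <= T)%N -> F s [set w | (tau w <= s)%N]).

Definition payoff X Y Z tau sigma : Omega -> R := fun w =>
  \1_[set w | (tau w < sigma w)%N] w * X (tau w) w +
  \1_[set w | (sigma w < tau w)%N] w * Y (sigma w) w +
  \1_[set w | sigma w = tau w] w * Z (sigma w) w.

Definition nash_equilibrium X Y Z t taustar sigmastar :=
  [/\ stopping_time t taustar, stopping_time t sigmastar &
    forall tau sigma, stopping_time t tau -> stopping_time t sigma ->
      \forall w \ae P,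
        condexp P (F t) (payoff X Y Z tau sigmastar) w <=
        condexp P (F t) (payoff X Y Z taustar sigmastar) w <=
        condexp P (F t) (payoff X Y Z taustar sigma) w].

(* The equations are required almost surely, so that V may be built from any
   versions of the conditional expectations; adaptedness then rules out
   non-measurable modifications on null sets. *)
Definition dynkin_recursion X Y Z V :=
  let L t w := Num.min (X t w) (Z t w) in
  let U t w := Num.max (Y t w) (Z t w) in
  [/\ adapted V,
      \forall w \ae P, V T w = Z T w &
      forall t, (t < T)%N -> \forall w \ae P,
        V t w = Num.min (U t w) (Num.max (L t w) (condexp P (F t) (V t.+1) w))].

End dynkin_game.

(* Main.v *)
Require Import Defs.
From mathcomp Require Import all_boot all_order all_algebra.
From mathcomp Require Import all_classical all_reals all_analysis.
From mathcomp Require Import measurable_realfun.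

Set Implicit Arguments.
Unset Strict Implicit.
Unset Printing Implicit Defensive.

Import Order.TTheory GRing.Theory Num.Theory.

Local Open Scope classical_set_scope.
Local Open Scope ring_scope.

(** Write [L = min X Z] and [U = max Y Z], so that [L <= Z <= U].

    Suppose first that [V] lies between [min X Y] and [max X Y].  The
    max-player stops as soon as [V <= L] and the min-player as soon as
    [V >= U].  When the max-player stops, [V <= L] is below both [X] and [Z],
    so the min-player cannot push the payoff below [V], whether or not he
    stops at the same time.  When the max-player continues, [V] exceeds [L],
    so the recursion bounds [V] by the conditional expectation of the next
    value; and if the min-player stops at that time the payoff is [Y], which
    is at least [V]: this is clear if [Z <= Y], and if [Y < Z] then
    [V <= U = Z] and [V > L] force [V > X], so that [V <= max X Y] gives
    [V <= Y].  Hence the max-player guarantees [V]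
    ([subsolution_guarantee]), by symmetry the min-player guarantees [V] too,
    and the two strategies form an equilibrium.

    Conversely, [V <= max X Y] follows from the equilibria by backward
    induction ([nash_subsolution_le]).  Given an equilibrium at time [t], let
    [A] and [B] be the events that the max-player and the min-player stop at
    once.  On [B], [V <= U = max Y Z] and [Z] is controlled: on [A] the
    min-player does not gain by waiting, so [Z <= X], and off [A] the
    max-player does not gain by stopping, so [Z <= Y].  Off [B], [V] is at
    most [L <= X] or the continuation value [E]; by the induction hypothesis the
    max-player can guarantee [E] by waiting, so [E] is at most the equilibrium
    value, which is [X] on [A] and, because the min-player may stop, at most
    [Y] off [A].

    Both arguments use only the upper bounds on [V] that the recursion
    provides ([subsolution]).  Exchanging the players, that is, passing from
    [(X, Y, Z, V)] to [(- Y, - X, - Z, - V)], turns the recursion into itself,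
    so each argument also gives the opposite bound.

    Almost sure inequalities between conditional expectations given [F t] are
    handled as inequalities between integrals over the events of [F t]
    ([condexp_leP]): these are transitive, can be cut along events of [F t],
    and pass from [F t.+1] to the smaller [F t], which replaces the tower
    property. *)

(** * Sub-sigma-algebras and integral inequalities *)

Section sub_sigma_algebra.
Context {d : measure_display} {Omega : measurableType d} {R : realType}.
Variables (G : set (set Omega)) (hG : sub_sigma_algebra_of G).
Implicit Types (A B : set Omega) (f g : Omega -> R).

Let GE : G.-sigma.-measurable = G.
Proof. by apply: measurable_g_measurableTypeE; case: hG. Qed.

Lemma sub_sigmaT : G setT.
Proof. by rewrite -GE; exact: measurableT. Qed.

Lemma sub_sigma0 : G set0.
Proof. by rewrite -GE; exact: measurable0. Qed.

Lemma sub_sigmaC A : G A -> G (~` A).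
Proof. by rewrite -GE; exact: measurableC. Qed.

Lemma sub_sigmaI A B : G A -> G B -> G (A `&` B).
Proof. by rewrite -GE; exact: measurableI. Qed.

Lemma sub_sigmaU A B : G A -> G B -> G (A `|` B).
Proof. by rewrite -GE; exact: measurableU. Qed.

Lemma sub_sigma_measurable A : G A -> measurable A.
Proof. by case: hG => _; exact. Qed.

Lemma sub_sigma_le f g : measurable_wrt G f -> measurable_wrt G g ->
  G [set w | f w <= g w].
Proof.
move=> mf mg; rewrite -GE -[X in _ X]setTI.
exact: (measurable_fun_le measurableT mf mg).
Qed.

Lemma measurable_wrt_measurable f : measurable_wrt G f -> measurable_fun setT f.
Proof.
move=> mf _ B mB; apply: sub_sigma_measurable.
by rewrite -GE; exact: (mf measurableT B mB).
Qed.

Lemma measurable_wrtN f : measurable_wrt G f -> measurable_wrt G (\- f).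
Proof. exact: (measurableT_comp (@oppr_measurable R setT)). Qed.

End sub_sigma_algebra.

Section integral_order.
Context {d : measure_display} {Omega : measurableType d} {R : realType}.
Variable P : probability Omega R.
Implicit Types (G : set (set Omega)) (A D E : set Omega) (f g h : Omega -> R).

(** The restriction to a set [D] lets different parts of the sample space be
    treated by different arguments. *)
Definition integral_le_on G D f g := forall A, G A -> A `<=` D ->
  (\int[P]_(w in A) (f w)%:E <= \int[P]_(w in A) (g w)%:E)%E.

Lemma integral_le_on_trans G D f g h :
  integral_le_on G D f g -> integral_le_on G D g h -> integral_le_on G D f h.
Proof. by move=> fg gh A GA AD; apply: le_trans (fg _ GA AD) (gh _ GA AD). Qed.

(** Enlarging the algebra strengthens the relation, so an inequality at a
    later time of a filtration holds at all earlier times. *)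
Lemma integral_le_onS G H D E f g : G `<=` H -> D `<=` E ->
  integral_le_on H E f g -> integral_le_on G D f g.
Proof.
by move=> GH DE fg A GA AD; apply: fg; [exact: GH|exact: subset_trans DE].
Qed.

Lemma integral_le_on_eq G D f f' g g' :
  (forall w, D w -> f w = f' w) -> (forall w, D w -> g w = g' w) ->
  integral_le_on G D f g -> integral_le_on G D f' g'.
Proof.
move=> ff' gg' fg A GA AD.
suff E h h' : (forall w, D w -> h w = h' w) ->
    (\int[P]_(w in A) (h w)%:E = \int[P]_(w in A) (h' w)%:E)%E.
  by rewrite -(E _ _ ff') -(E _ _ gg'); exact: fg.
by move=> hh'; apply: eq_integral => w /set_mem/AD/hh' ->.
Qed.

Local Notation intg f := (P.-integrable setT (EFin \o f)).

Lemma integrable_ae_dominated f g h : measurable_fun setT f ->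
  intg g -> intg h -> (\forall w \ae P, `|f w| <= `|g w| + `|h w|) -> intg f.
Proof.
move=> mf gi hi fgh; apply/integrableP.
split; first exact/measurable_EFinP.
have /integrableP[mgh] : P.-integrable setT
    ((abse \o (EFin \o g)) \+ (abse \o (EFin \o h)))%E.
  by apply: integrableD => //; exact: integrable_abse.
apply: le_lt_trans; apply: ae_ge0_le_integral => //.
- by apply: measurableT_comp => //; exact/measurable_EFinP.
- exact: measurableT_comp mgh.
apply: filterS fgh => w fgh _ /=.
by rewrite lee_fin; exact: le_trans fgh (ler_norm _).
Qed.

Lemma integrable_maxr f g : intg f -> intg g -> intg (f \max g).
Proof.
move=> fi gi; apply: (integrable_ae_dominated _ fi gi).
  by apply: measurable_maxr; apply/measurable_EFinP; exact: (measurable_int P).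
apply: aeW => w /=.
by rewrite /Num.max; case: ifP => _; rewrite ?lerDl ?lerDr normr_ge0.
Qed.

Lemma integrable_minr f g : intg f -> intg g -> intg (f \min g).
Proof.
move=> fi gi; apply: (integrable_ae_dominated _ fi gi).
  by apply: measurable_minr; apply/measurable_EFinP; exact: (measurable_int P).
apply: aeW => w /=.
by rewrite /Num.min; case: ifP => _; rewrite ?lerDl ?lerDr normr_ge0.
Qed.

Lemma integrable_oppr f : intg f -> intg (\- f).
Proof. exact: integrableN. Qed.

Section subalgebra.
Variable G : set (set Omega).
Hypothesis hG : sub_sigma_algebra_of G.

Let Gm A : G A -> measurable A := sub_sigma_measurable hG (A:=A).

Let intS A f : G A -> intg f -> P.-integrable A (EFin \o f).
Proof. by move=> /Gm mA; exact: integrableS. Qed.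

Lemma integral_le_onN D f g : intg f -> intg g ->
  integral_le_on G D f g -> integral_le_on G D (\- g) (\- f).
Proof.
move=> fi gi fg A GA AD.
have oppE h : intg h ->
    (\int[P]_(w in A) ((\- h) w)%:E = - \int[P]_(w in A) (h w)%:E)%E.
  move=> hi; rewrite -integralN; last first.
    by apply: integrable_add_def; [exact: Gm|exact: intS].
  by apply: eq_integral => w _; rewrite EFinN.
by rewrite !oppE// leeN2; exact: fg.
Qed.

(** Neither [f] nor [g] is nonnegative and [f <= g] may fail on a null set,
    whence the detour through [f \max g], which is above [f] everywhere and
    equals [g] almost everywhere on [D]. *)
Lemma integral_le_on_ae D f g : intg f -> intg g ->
  (\forall w \ae P, D w -> f w <= g w) -> integral_le_on G D f g.
Proof.
move=> fi gi fg A GA AD; have mA := Gm GA.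
have hi : intg (f \max g) by exact: integrable_maxr.
have -> : (\int[P]_(w in A) (g w)%:E = \int[P]_(w in A) ((f \max g) w)%:E)%E.
  apply: ae_eq_integral => //.
  - exact: measurable_int (intS GA gi).
  - by apply: (measurable_int P); exact: integrableS hi.
  apply: filterS fg => w fg /AD /fg fgw.
  by rewrite /= max_r.
apply: le_integral => //; first exact: intS.
  exact: integrableS hi.
by move=> w _; rewrite lee_fin le_max lexx.
Qed.

Lemma integral_le_on_cut E D f g : intg f -> intg g -> G E ->
  integral_le_on G (D `&` E) f g -> integral_le_on G (D `&` ~` E) f g ->
  integral_le_on G D f g.
Proof.
move=> fi gi GE fgE fgE' A GA AD.
have GAE : G (A `&` E) by exact: sub_sigmaI.
have GAE' : G (A `&` ~` E) by apply: sub_sigmaI => //; exact: sub_sigmaC.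
have cutE h : intg h -> (\int[P]_(w in A) (h w)%:E =
    \int[P]_(w in A `&` E) (h w)%:E + \int[P]_(w in A `&` ~` E) (h w)%:E)%E.
  move=> hi; rewrite -[in LHS](setIT A) -(setUv E) setIUr.
  rewrite integral_setU_EFin//; try exact: Gm.
    rewrite -setIUr setUv setIT; apply/measurable_EFinP.
    exact: measurable_int (intS GA hi).
  apply/disj_setPS => w [[_ +] [_ +]]; exact.
rewrite !cutE//; apply: leeD.
  by apply: fgE => // w [/AD].
by apply: fgE' => // w [/AD].
Qed.

(** The event of [D] where the inequality fails belongs to [G]; the positive
    function [f - g] has a nonpositive integral over it, so it is null. *)
Lemma ae_le_integral_le_on D f g : G D -> intg f -> intg g ->
  measurable_wrt G f -> measurable_wrt G g -> integral_le_on G D f g ->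
  \forall w \ae P, D w -> f w <= g w.
Proof.
move=> GD fi gi mf mg fg.
pose N := D `&` ~` [set w | f w <= g w].
have GN : G N.
  by apply: sub_sigmaI => //; apply: sub_sigmaC => //; exact: sub_sigma_le.
have mN := Gm GN.
have fgi : P.-integrable N (fun w => (f w)%:E - (g w)%:E)%E.
  by apply: integrableB => //; exact: intS.
have N0 : (\int[P]_(w in N) `|(f w)%:E - (g w)%:E| = 0)%E.
  apply/eqP; rewrite eq_le; apply/andP; split; last exact: integral_ge0.
  have -> : (\int[P]_(w in N) `|(f w)%:E - (g w)%:E| =
      \int[P]_(w in N) ((f w)%:E - (g w)%:E))%E.
    apply: eq_integral => w /set_mem[_ /negP]; rewrite -ltNge => gf.
    by rewrite -EFinB abse_EFin ger0_norm// subr_ge0 ltW.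
  rewrite integralB_EFin//; try exact: intS.
  by rewrite sube_le0; apply: fg => // w [].
have /(ae_eq_integral_abs _ mN) := N0.
move=> /(_ (measurable_int _ fgi)); apply: filterS => w Nw Dw.
rewrite leNgt; apply/negP => gf.
have /Nw/= : N w by split => //; apply/negP; rewrite -ltNge.
by move=> [] /eqP; rewrite subr_eq0 => /eqP fgw; rewrite fgw ltxx in gf.
Qed.

Lemma condexp_integrable f : intg f -> intg (condexp P G f).
Proof. by move=> /(condexpP hG)[]. Qed.

Lemma condexp_measurable f : intg f -> measurable_wrt G (condexp P G f).
Proof. by move=> /(condexpP hG)[]. Qed.

(** A conditional expectation has the same integrals as [f] over the events of
    [G]; stated as two inequalities, this composes with
    [integral_le_on_trans]. *)
Lemma condexp_le_on D f : intg f -> integral_le_on G D (condexp P G f) f.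
Proof. by move=> /(condexpP hG)[_ _ e] A GA _; rewrite e. Qed.

Lemma le_condexp_on D f : intg f -> integral_le_on G D f (condexp P G f).
Proof. by move=> /(condexpP hG)[_ _ e] A GA _; rewrite e. Qed.

Lemma condexp_leP f g : intg f -> intg g ->
  (\forall w \ae P, condexp P G f w <= condexp P G g w) <->
  integral_le_on G setT f g.
Proof.
move=> fi gi; split=> fg.
  apply: integral_le_on_trans (le_condexp_on fi) _.
  apply: integral_le_on_trans (condexp_le_on gi).
  apply: integral_le_on_ae; try exact: condexp_integrable.
  by apply: filterS fg.
have : \forall w \ae P, setT w -> condexp P G f w <= condexp P G g w.
  apply: ae_le_integral_le_on; try exact: condexp_integrable.
  - exact: sub_sigmaT.
  - exact: condexp_measurable.
  - exact: condexp_measurable.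
  apply: integral_le_on_trans (condexp_le_on fi) _.
  exact: integral_le_on_trans (le_condexp_on gi).
by apply: filterS => w; exact.
Qed.

(** The chosen versions of the two conditional expectations agree up to sign
    almost surely; the duality between the players needs one of the two
    inequalities. *)
Lemma le_condexpN f : intg f ->
  \forall w \ae P, - condexp P G f w <= condexp P G (\- f) w.
Proof.
move=> fi; have Ei := condexp_integrable fi; have Nfi := integrable_oppr fi.
have : \forall w \ae P, setT w -> (\- condexp P G f) w <= condexp P G (\- f) w.
  apply: ae_le_integral_le_on.
  - exact: sub_sigmaT.
  - exact: integrable_oppr.
  - exact: condexp_integrable.
  - by apply: measurable_wrtN; exact: condexp_measurable.
  - exact: condexp_measurable.
  apply: integral_le_on_trans (le_condexp_on Nfi).
  by apply: integral_le_onN => //; exact: le_condexp_on.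
by apply: filterS => w; exact.
Qed.

End subalgebra.
End integral_order.

(** * Stopping times *)

Section stopping_times.
Context {d : measure_display} {Omega : measurableType d}.
Variables (T : nat) (F : nat -> set (set Omega)).
Hypothesis hF : filtration T F.
Implicit Types (t s : nat) (A : set Omega) (tau sigma : Omega -> nat).

Lemma filtration_sub t : (t <= T)%N -> sub_sigma_algebra_of (F t).
Proof. by case: hF => + _; exact. Qed.

Lemma stopping_timeW t tau : stopping_time T F t.+1 tau -> stopping_time T F t tau.
Proof.
by move=> [tauT ?]; split=> // w; have /andP[/ltnW -> ->] := tauT w.
Qed.

Lemma stopping_time_cst t s : (t <= s <= T)%N -> stopping_time T F t (fun=> s).
Proof.
move=> tsT; split=> // r rT; have hr := filtration_sub rT.
have [sr|rs] := leqP s r.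
  rewrite (_ : [set _ | _] = setT); first exact: sub_sigmaT hr.
  by apply/seteqP; split.
rewrite (_ : [set _ | _] = set0); first exact: sub_sigma0 hr.
by apply/seteqP; split=> // w /=; rewrite leqNgt rs.
Qed.

(** A strategy that does not stop at [t] agrees with its delayed version, and
    so can be used in the game started at [t.+1]. *)
Lemma stopping_time_delay t sigma : (t < T)%N -> stopping_time T F t sigma ->
  stopping_time T F t.+1 (fun w => maxn (sigma w) t.+1).
Proof.
move=> tT [sT Fs]; split=> [w|r rT].
  by rewrite leq_maxr geq_max tT andbT; have /andP[] := sT w.
have hr := filtration_sub rT.
have [tr|rt] := leqP t.+1 r.
  rewrite (_ : [set _ | _] = [set w | (sigma w <= r)%N]); first exact: Fs.
  by apply/seteqP; split=> w /=; rewrite geq_max tr andbT.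
rewrite (_ : [set _ | _] = set0); first exact: sub_sigma0 hr.
by apply/seteqP; split=> // w /=; rewrite geq_max [(t < r)%N]leqNgt rt andbF.
Qed.

Lemma stopping_time_if t A tau : (t < T)%N -> F t A ->
  stopping_time T F t.+1 tau ->
  stopping_time T F t (fun w => if w \in A then t else tau w).
Proof.
move=> tT FA [tauT Ftau]; split=> [w|r rT].
  have [_|_] := boolP (w \in A); first by rewrite leqnn ltnW.
  by have /andP[/ltnW -> ->] := tauT w.
have hr := filtration_sub rT.
have [tr|rt] := leqP t r.
  rewrite (_ : [set _ | _] = A `|` [set w | (tau w <= r)%N]).
    apply: (sub_sigmaU hr); last exact: Ftau.
    by case: hF => _ /(_ t r); apply => //; rewrite tr.
  apply/seteqP; split=> w /=.
    by have [/set_mem ? _|_ ?] := boolP (w \in A); [left|right].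
  by have [_ _|/negP wA [/mem_set|]] := boolP (w \in A).
rewrite (_ : [set _ | _] = set0); first exact: sub_sigma0 hr.
apply/seteqP; split=> // w /=.
have [_|_] := boolP (w \in A); first by rewrite leqNgt rt.
by have /andP[tw _] := tauT w; rewrite leqNgt (ltn_trans rt tw).
Qed.

Lemma stopping_time_measurable t tau : stopping_time T F t tau ->
  measurable_fun setT tau.
Proof.
move=> [tauT Ftau].
have mle s : measurable [set w | (tau w <= s)%N].
  have [sT|/ltnW Ts] := leqP s T.
    exact: (sub_sigma_measurable (filtration_sub sT) (Ftau _ sT)).
  rewrite (_ : [set _ | _] = setT)//; apply/seteqP; split=> // w _ /=.
  by have /andP[_ /leq_trans] := tauT w; apply.
have meq s : measurable [set w | tau w = s].
  case: s => [|s].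
    rewrite (_ : [set _ | _] = [set w | (tau w <= 0)%N])//.
    by apply/seteqP; split=> w /=; rewrite leqn0 => /eqP.
  rewrite (_ : [set _ | _] =
      [set w | (tau w <= s.+1)%N] `\` [set w | (tau w <= s)%N]).
    exact: measurableD.
  apply/seteqP; split=> w /=; first by move->; rewrite leqnn ltnn.
  by move=> [le1 /negP]; rewrite -ltnNge => lt1; apply/eqP; rewrite eqn_leq le1.
move=> _ B _; rewrite setTI (_ : _ @^-1` B = \bigcup_(s in B) [set w | tau w = s]).
  exact: bigcup_measurable.
by apply/seteqP; split=> [w Bw|w [s Bs /= ->]//]; exists (tau w).
Qed.

End stopping_times.

(** * Payoffs *)

Section payoffs.
Context {d : measure_display} {Omega : measurableType d} {R : realType}.
Implicit Types (X Y Z : nat -> Omega -> R) (tau sigma : Omega -> nat).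

Let indic_bool (b : Omega -> bool) w : \1_[set w | b w] w = (b w)%:R :> R.
Proof.
rewrite indicE; congr (_ _); congr nat_of_bool; apply/idP/idP => [/set_mem//|].
exact: mem_set.
Qed.

Lemma payoffE X Y Z tau sigma w : payoff X Y Z tau sigma w =
  if (tau w < sigma w)%N then X (tau w) w
  else if (sigma w < tau w)%N then Y (sigma w) w else Z (sigma w) w.
Proof.
rewrite /payoff.
rewrite (_ : [set w | sigma w = tau w] = [set w | sigma w == tau w]); last first.
  by apply/seteqP; split=> v /eqP.
rewrite !indic_bool.
by case: ltngtP => _; rewrite !(mul0r, mul1r, add0r, addr0).
Qed.

Lemma payoff_lt X Y Z tau sigma w : (tau w < sigma w)%N ->
  payoff X Y Z tau sigma w = X (tau w) w.
Proof. by rewrite payoffE => ->. Qed.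

Lemma payoff_gt X Y Z tau sigma w : (sigma w < tau w)%N ->
  payoff X Y Z tau sigma w = Y (sigma w) w.
Proof. by rewrite payoffE => lt; rewrite lt ltnNge (ltnW lt). Qed.

Lemma payoff_eq X Y Z tau sigma w : tau w = sigma w ->
  payoff X Y Z tau sigma w = Z (sigma w) w.
Proof. by rewrite payoffE => ->; rewrite !ltnn. Qed.

(** Reversing the sign of the payoff exchanges the two players, and with them
    [X] and [Y]. *)
Lemma payoff_dual X Y Z tau sigma :
  payoff (fun t => \- Y t) (fun t => \- X t) (fun t => \- Z t) sigma tau =
  \- payoff X Y Z tau sigma.
Proof.
apply/funext => w; rewrite /= !payoffE.
by case: ltngtP => // ->.
Qed.

Variable P : probability Omega R.

Local Notation intg f := (P.-integrable setT (EFin \o f)).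

Lemma integrable_addr (f g : Omega -> R) :
  intg f -> intg g -> intg (fun w => f w + g w).
Proof. exact: integrableD. Qed.

Lemma integrable_indicM (A : set Omega) (f : Omega -> R) : measurable A ->
  intg f -> intg (fun w => \1_A w * f w).
Proof.
move=> mA fi; apply: (integrable_ae_dominated _ fi fi).
  apply: measurable_funM; first exact: measurable_indic.
  by apply/measurable_EFinP; exact: (measurable_int P).
apply: aeW => w; rewrite indicE.
by case: (w \in A); rewrite ?mul1r ?mul0r ?normr0 ?addr_ge0 ?lerDl.
Qed.

(** The sampled variable is a finite sum over the possible values of [N]. *)
Lemma integrable_sample T (N : Omega -> nat) (X : nat -> Omega -> R) :
  measurable_fun setT N -> (forall w, (N w <= T)%N) ->
  integrable_process P T X -> intg (fun w => X (N w) w).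
Proof.
move=> mN NT Xi.
have -> : (EFin \o (fun w => X (N w) w)) =
    (fun w => \sum_(s < T.+1) (\1_[set w | N w == s] w * X s w)%:E)%E.
  apply/funext => w; rewrite sumEFin /=; congr EFin.
  have NwT : (N w < T.+1)%N by rewrite ltnS.
  rewrite (bigD1 (Ordinal NwT))//= indic_bool eqxx mul1r big1 ?addr0// => s sN.
  by rewrite indic_bool -[N w]/(val (Ordinal NwT)) val_eqE eq_sym (negbTE sN) mul0r.
apply: integrable_sum => // s _; apply: integrable_indicM.
  rewrite -[X in measurable X]setTI.
  exact: (mN measurableT [set n | n == s :> nat]).
by apply: Xi; rewrite -ltnS.
Qed.

Lemma integrable_payoff T F X Y Z t tau sigma : filtration T F ->
  integrable_process P T X -> integrable_process P T Y ->
  integrable_process P T Z -> stopping_time T F t tau ->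
  stopping_time T F t sigma -> intg (payoff X Y Z tau sigma).
Proof.
move=> hF Xi Yi Zi ht hs.
have mt := stopping_time_measurable hF ht.
have ms := stopping_time_measurable hF hs.
have tT w : (tau w <= T)%N by case: ht => /(_ w)/andP[].
have sT w : (sigma w <= T)%N by case: hs => /(_ w)/andP[].
have mset (b : Omega -> bool) :
    measurable_fun setT b -> measurable [set w | b w].
  move=> mb; rewrite -[X in measurable X]setTI.
  exact: (mb measurableT [set true]).
rewrite /payoff; do 2?[apply: integrable_addr]; apply: integrable_indicM => //.
- exact/mset/measurable_fun_ltn.
- exact: integrable_sample.
- exact/mset/measurable_fun_ltn.
- exact: integrable_sample.
- rewrite (_ : [set _ | _] = [set w | sigma w == tau w]).
    exact/mset/measurable_fun_eqn.
  by apply/seteqP; split=> v /eqP.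
- exact: integrable_sample.
Qed.

End payoffs.

(** * Guarantees and equilibria *)

Section games.
Context {d : measure_display} {Omega : measurableType d} {R : realType}.
Variables (P : probability Omega R) (T : nat) (F : nat -> set (set Omega)).
Hypothesis hF : filtration T F.
Implicit Types (t s : nat) (tau sigma : Omega -> nat) (f g : Omega -> R).

Local Notation intg f := (P.-integrable setT (EFin \o f)).
Local Notation stopping t := (stopping_time T F t).
Local Notation le_on t := (integral_le_on P (F t)).

(** The half of the recursion that bounds [V] from above.  The other half says
    that [- V] is a subsolution of the game with the players exchanged, see
    [dynkin_recursion_dual_subsolution]. *)
Definition subsolution (X Y Z V : nat -> Omega -> R) :=
  [/\ adapted T F V, integrable_process P T V,
      \forall w \ae P, V T w <= Z T w &
      forall t, (t < T)%N -> \forall w \ae P,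
        V t w <= Num.min (Num.max (Y t w) (Z t w))
          (Num.max (Num.min (X t w) (Z t w)) (condexp P (F t) (V t.+1) w))].

(** The saddle point inequalities before conditional expectations are taken;
    see [nash_equilibriumP]. *)
Definition integral_nash (X Y Z : nat -> Omega -> R) t taustar sigmastar :=
  [/\ stopping t taustar, stopping t sigmastar &
    forall tau sigma, stopping t tau -> stopping t sigma ->
      le_on t setT (payoff X Y Z tau sigmastar) (payoff X Y Z taustar sigmastar) /\
      le_on t setT (payoff X Y Z taustar sigmastar) (payoff X Y Z taustar sigma)].

Section one_player.
Variables X Y Z V : nat -> Omega -> R.
Hypotheses (Xad : adapted T F X) (Yad : adapted T F Y) (Zad : adapted T F Z).
Hypotheses (Xi : integrable_process P T X) (Yi : integrable_process P T Y).
Hypotheses (Zi : integrable_process P T Z) (hV : subsolution X Y Z V).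

Let le_onS t D D' f g : D `<=` D' -> le_on t D' f g -> le_on t D f g.
Proof. exact: integral_le_onS (@subset_refl _ _). Qed.

Let payoffi t tau sigma : stopping t tau -> stopping t sigma ->
  intg (payoff X Y Z tau sigma).
Proof. exact: integrable_payoff. Qed.

(** Backward induction: the max-player stops at [t] where [V t <= L t], and
    otherwise follows a strategy that guarantees [V t.+1] from [t.+1] on. *)
Lemma subsolution_guarantee t : (t <= T)%N ->
  (forall s, (t <= s <= T)%N ->
     \forall w \ae P, V s w <= Num.max (X s w) (Y s w)) ->
  exists2 tau, stopping t tau & forall sigma, stopping t sigma ->
    le_on t setT (V t) (payoff X Y Z tau sigma).
Proof.
case: hV => Vad Vi VT Vrec.
move=> tT; have [k] := ubnP (T - t); elim: k t tT => // k IH t tT.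
rewrite ltnS => tk Vmax.
have ht := filtration_sub hF tT.
have [tltT|Tt] := ltnP t T; last first.
  have {Tt}tE : t = T by apply/eqP; rewrite eqn_leq tT.
  rewrite {}tE in tT tk Vmax ht *.
  have sT : stopping T (fun=> T) by apply: (stopping_time_cst hF); rewrite leqnn.
  exists (fun=> T) => // sigma hs.
  apply: (integral_le_on_ae ht (Vi _ tT) (payoffi sT hs)).
  apply: filterS VT => w VZ _.
  have sigE : sigma w = T.
    by apply/eqP; case: hs => /(_ w); rewrite andbC -eqn_leq.
  by rewrite payoff_eq ?sigE.
have [tau htau guar] : exists2 tau, stopping t.+1 tau &
    forall sigma, stopping t.+1 sigma ->
      le_on t.+1 setT (V t.+1) (payoff X Y Z tau sigma).
  apply: IH => //; first exact: leq_trans (ltn_sub2l tltT (ltnSn t)) tk.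
  by move=> s /andP[/ltnW ts sT]; apply: Vmax; rewrite ts.
(* A and B are the events that the max-player and the min-player stop at t. *)
pose A := [set w | V t w <= (X t \min Z t) w].
have FA : F t A.
  apply: (sub_sigma_le ht); first exact: Vad.
  by apply: measurable_minr; [exact: Xad|exact: Zad].
pose taut w := if w \in A then t else tau w.
have htaut : stopping t taut by exact: stopping_time_if.
exists taut => // sigma hs.
pose B := [set w | (sigma w <= t)%N].
have FB : F t B by case: hs => _; exact.
have pi := payoffi htaut hs.
have tauA w : A w -> taut w = t by move=> Aw; rewrite /taut mem_set.
have tauA' w : ~ A w -> taut w = tau w by move=> Aw; rewrite /taut memNset.
have sigB w : B w -> sigma w = t.
  by move=> Bw; apply/eqP; rewrite eqn_leq Bw; case: hs => /(_ w)/andP[].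
have sigB' w : ~ B w -> (t < sigma w)%N by move=> /negP; rewrite -ltnNge.
have tautau w : (t < tau w)%N by case: htau => /(_ w)/andP[].
apply: (integral_le_on_cut ht (Vi _ tT) pi FA);
  apply: (integral_le_on_cut ht (Vi _ tT) pi FB).
- apply: (integral_le_on_ae ht (Vi _ tT) pi); apply: aeW => w [[_ Aw] Bw].
  rewrite payoff_eq ?tauA ?sigB//.
  by move: Aw; rewrite /A /= le_min => /andP[].
- apply: (integral_le_on_ae ht (Vi _ tT) pi); apply: aeW => w [[_ Aw] Bw].
  rewrite payoff_lt ?tauA//; last exact: sigB'.
  by move: Aw; rewrite /A /= le_min => /andP[].
(* As V t > L t, the value V t exceeds X t or Z t; the other bounds leave Y t. *)
- apply: (integral_le_on_ae ht (Vi _ tT) pi).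
  have := Vmax t; rewrite leqnn tT => /(_ isT); move: (Vrec _ tltT).
  apply: filterS2 => w; rewrite le_min => /andP[+ _].
  rewrite !le_max => VYZ VXY [[_ Aw] Bw].
  rewrite payoff_gt ?tauA' ?sigB//.
  move: Aw VYZ VXY => /negP; rewrite /A /= le_min.
  by case: (V t w <= Y t w) => //; case: (V t w <= X t w); case: (V t w <= Z t w).
(* V t <= E (V t.+1 | F t), and the strategy tau guarantees V t.+1. *)
- have Vi1 := Vi _ tltT.
  apply: (integral_le_on_trans (g := condexp P (F t) (V t.+1))).
    apply: (integral_le_on_ae ht (Vi _ tT) (condexp_integrable ht Vi1)).
    apply: filterS (Vrec _ tltT) => w; rewrite le_min => /andP[_ +].
    rewrite le_max => + [[_ /negP Aw] _].
    by move: Aw; rewrite /A /= => /negbTE ->.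
  apply: (integral_le_on_trans (condexp_le_on ht Vi1)).
  apply: (integral_le_on_eq (f := V t.+1)
    (g := payoff X Y Z tau (fun w => maxn (sigma w) t.+1))) => //.
    move=> w [[_ Aw] Bw]; rewrite !payoffE tauA'//.
    by rewrite (maxn_idPl (sigB' _ Bw)).
  have := guar _ (stopping_time_delay hF tltT hs).
  by apply: integral_le_onS => //; case: hF => _; apply; rewrite leqnSn.
Qed.

(** Backward induction: the bounds at later times make [V t.+1] a value that
    the max-player can guarantee by waiting at [t]. *)
Lemma nash_subsolution_le :
  (\forall w \ae P, Z T w <= Num.max (X T w) (Y T w)) ->
  (forall t, (t <= T)%N -> exists tau sigma, integral_nash X Y Z t tau sigma) ->
  forall t, (t <= T)%N -> \forall w \ae P, V t w <= Num.max (X t w) (Y t w).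
Proof.
case: (hV) => Vad Vi VT Vrec ZT nash.
move=> t tT; have [k] := ubnP (T - t); elim: k t tT => // k IH t tT.
rewrite ltnS => tk.
have ht := filtration_sub hF tT.
have [tltT|Tt] := ltnP t T; last first.
  have -> : t = T by apply/eqP; rewrite eqn_leq tT.
  by move: VT ZT; apply: filterS2 => w; exact: le_trans.
have [tau htau guar] := subsolution_guarantee tltT
  (fun s (tsT : (t < s <= T)%N) => IH s (proj2 (andP tsT))
     (leq_trans (ltn_sub2l tltT (proj1 (andP tsT))) tk)).
have [ts [ss [hts hss eqm]]] := nash t tT.
have st : stopping t (fun=> t) by apply: (stopping_time_cst hF); rewrite leqnn.
have sT : stopping t (fun=> T) by apply: (stopping_time_cst hF); rewrite tT leqnn.
pose A := [set w | (ts w <= t)%N]; pose B := [set w | (ss w <= t)%N].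
have FA : F t A by case: hts => _; exact.
have FB : F t B by case: hss => _; exact.
have FA' := sub_sigmaC ht FA; have FB' := sub_sigmaC ht FB.
have tsA w : A w -> ts w = t.
  by move=> Aw; apply/eqP; rewrite eqn_leq Aw; case: hts => /(_ w)/andP[].
have ssB w : B w -> ss w = t.
  by move=> Bw; apply/eqP; rewrite eqn_leq Bw; case: hss => /(_ w)/andP[].
have tsA' w : ~ A w -> (t < ts w)%N by move=> /negP; rewrite -ltnNge.
have ssB' w : ~ B w -> (t < ss w)%N by move=> /negP; rewrite -ltnNge.
(* The min-player does not gain by waiting until T > t. *)
have ZX : \forall w \ae P, (A `&` B) w -> Z t w <= X t w.
  apply: (ae_le_integral_le_on ht (sub_sigmaI ht FA FB) (Zi tT) (Xi tT)
    (Zad tT) (Xad tT)).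
  have [_] := eqm _ _ st sT; move/(@le_onS t (A `&` B) _ _ _ (@subsetT _ _)).
  apply: integral_le_on_eq => w [Aw Bw].
    by rewrite payoff_eq ?ssB ?tsA.
  by rewrite payoff_lt tsA.
(* The max-player does not gain by stopping at t. *)
have ZY : \forall w \ae P, (~` A `&` B) w -> Z t w <= Y t w.
  apply: (ae_le_integral_le_on ht (sub_sigmaI ht FA' FB) (Zi tT) (Yi tT)
    (Zad tT) (Yad tT)).
  have [+ _] := eqm _ _ st sT; move/(@le_onS t (~` A `&` B) _ _ _ (@subsetT _ _)).
  apply: integral_le_on_eq => w [Aw Bw].
    by rewrite payoff_eq ssB.
  by rewrite payoff_gt ssB//; exact: tsA'.
have Vi1 := Vi _ tltT.
have Ei := condexp_integrable ht Vi1; have mE := condexp_measurable ht Vi1.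
(* The max-player does not gain by playing tau, which guarantees V t.+1. *)
have ER : le_on t (~` B) (condexp P (F t) (V t.+1)) (payoff X Y Z ts ss).
  apply: (integral_le_on_trans (condexp_le_on ht Vi1)).
  apply: (integral_le_on_trans (g := payoff X Y Z tau ss)); last first.
    have [+ _] := eqm _ _ (stopping_timeW htau) sT.
    exact: le_onS.
  apply: (integral_le_on_eq (f := V t.+1)
    (g := payoff X Y Z tau (fun w => maxn (ss w) t.+1))) => //.
    by move=> w Bw; rewrite !payoffE (maxn_idPl (ssB' _ Bw)).
  have := guar _ (stopping_time_delay hF tltT hss).
  by apply: integral_le_onS => //; case: hF => _; apply; rewrite leqnSn.
have EX : \forall w \ae P, (A `&` ~` B) w -> condexp P (F t) (V t.+1) w <= X t w.
  apply: (ae_le_integral_le_on ht (sub_sigmaI ht FA FB') Ei (Xi tT) mE (Xad tT)).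
  apply: (integral_le_on_eq (f:=condexp P (F t) (V t.+1))
      (g:=payoff X Y Z ts ss)) => //.
    by move=> w [Aw Bw]; rewrite payoff_lt tsA//; exact: ssB'.
  by apply: le_onS ER => w [].
(* The min-player does not gain by stopping at t. *)
have EY : \forall w \ae P, (~` A `&` ~` B) w -> condexp P (F t) (V t.+1) w <= Y t w.
  apply: (ae_le_integral_le_on ht (sub_sigmaI ht FA' FB') Ei (Yi tT) mE (Yad tT)).
  apply: (integral_le_on_trans (g := payoff X Y Z ts ss)).
    by apply: le_onS ER => w [].
  have [_] := eqm _ _ st st; move/(@le_onS t (~` A `&` ~` B) _ _ _ (@subsetT _ _)).
  apply: integral_le_on_eq => w [Aw Bw]//.
  by rewrite payoff_gt//; exact: tsA'.
apply: filterS3 (Vrec _ tltT) (filterI ZX ZY) (filterI EX EY) => w.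
rewrite le_min !le_max => /andP[VYZ VE] [{}ZX {}ZY] [{}EX {}EY].
have [Bw|Bw] := pselect (B w).
  case/orP: VYZ => [->|VZ]; first by rewrite orbT.
  have [Aw|Aw] := pselect (A w).
    by rewrite (le_trans VZ (ZX _)).
  by rewrite (le_trans VZ (ZY _)) ?orbT.
case/orP: VE => [|VE]; first by rewrite le_min => /andP[-> _].
have [Aw|Aw] := pselect (A w).
  by rewrite (le_trans VE (EX _)).
by rewrite (le_trans VE (EY _)) ?orbT.
Qed.

End one_player.


Lemma integral_nash_dual X Y Z t taustar sigmastar : (t <= T)%N ->
  integrable_process P T X -> integrable_process P T Y ->
  integrable_process P T Z ->
  integral_nash X Y Z t taustar sigmastar ->
  integral_nash (fun t => \- Y t) (fun t => \- X t) (fun t => \- Z t) t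
    sigmastar taustar.
Proof.
move=> tT Xi Yi Zi [hts hss eqm].
have ht := filtration_sub hF tT.
split=> // sigma tau hs htau; rewrite !payoff_dual.
have [le1 le2] := eqm _ _ htau hs.
by split; apply: (integral_le_onN ht) => //; exact: (integrable_payoff (t:=t) hF).
Qed.

Lemma nash_equilibriumP X Y Z t taustar sigmastar : (t <= T)%N ->
  integrable_process P T X -> integrable_process P T Y ->
  integrable_process P T Z ->
  nash_equilibrium P T F X Y Z t taustar sigmastar <->
  integral_nash X Y Z t taustar sigmastar.
Proof.
move=> tT Xi Yi Zi; have ht := filtration_sub hF tT.
have pi := fun tau sigma =>
  @integrable_payoff _ _ _ P T F X Y Z t tau sigma hF Xi Yi Zi.
split=> -[hts hss eqm]; split=> // tau sigma htau hs.
  have eqms := eqm _ _ htau hs.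
  split; apply/(condexp_leP ht); try exact: pi.
    by apply: filterS eqms => w /andP[].
  by apply: filterS eqms => w /andP[].
have [le1 le2] := eqm _ _ htau hs.
have {}le1 := (condexp_leP ht (pi _ _ htau hss) (pi _ _ hts hss)).2 le1.
have {}le2 := (condexp_leP ht (pi _ _ hts hss) (pi _ _ hts hs)).2 le2.
by move: le1 le2; apply: filterS2 => w -> ->.
Qed.

End games.

(** * The recursion *)

Section recursion.
Context {d : measure_display} {Omega : measurableType d} {R : realType}.
Variables (P : probability Omega R) (T : nat) (F : nat -> set (set Omega)).
Hypothesis hF : filtration T F.
Variables X Y Z V : nat -> Omega -> R.
Hypotheses (Xi : integrable_process P T X) (Yi : integrable_process P T Y).
Hypotheses (Zi : integrable_process P T Z).
Hypothesis hV : dynkin_recursion P T F X Y Z V.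

Local Notation intg f := (P.-integrable setT (EFin \o f)).

(** Since [L <= U], the recursion forces [L <= V <= U]. *)
Lemma dynkin_recursion_integrable : integrable_process P T V.
Proof.
case: hV => Vad VT Vrec t tT.
have mV := measurable_wrt_measurable (filtration_sub hF tT) (Vad _ tT).
have [tltT|Tt] := ltnP t T; last first.
  have tE : t = T by apply/eqP; rewrite eqn_leq tT.
  rewrite tE in mV *.
  apply: (integrable_ae_dominated mV (Zi (leqnn T)) (Zi (leqnn T))).
  by apply: filterS VT => w ->; rewrite lerDl.
apply: (integrable_ae_dominated mV (integrable_minr (Xi tT) (Zi tT))
  (integrable_maxr (Yi tT) (Zi tT))).
apply: filterS (Vrec _ tltT) => w Vw.
set L := (_ \min _) w; set U := (_ \max _) w.
have LU : L <= U by rewrite /L /U /= ge_min !le_max lexx !orbT.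
have VU : V t w <= U by rewrite Vw ge_min lexx.
have LV : L <= V t w by rewrite Vw le_min LU le_max lexx.
rewrite ler_norml; apply/andP; split.
  rewrite (le_trans _ LV)// lerNl (le_trans (ler_norm _))// normrN lerDl.
  exact: normr_ge0.
by rewrite (le_trans VU)// (le_trans (ler_norm _))// lerDr normr_ge0.
Qed.

Lemma dynkin_recursion_subsolution : subsolution P T F X Y Z V.
Proof.
case: (hV) => Vad VT Vrec; split=> //.
- exact: dynkin_recursion_integrable.
- by apply: filterS VT => w ->.
- by move=> t /Vrec; apply: filterS => w ->.
Qed.

(** Since [L <= U], the recursion also gives [V >= max L (min U E)], where [E]
    is the continuation value; the exchange of players reverses the sign and
    makes this an upper bound. *)
Lemma dynkin_recursion_dual_subsolution : subsolution P T F
  (fun t => \- Y t) (fun t => \- X t) (fun t => \- Z t) (fun t => \- V t).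
Proof.
case: (hV) => Vad VT Vrec; have Vi := dynkin_recursion_integrable; split=> //.
- by move=> t tT; apply: measurable_wrtN; exact: Vad.
- by move=> t tT; apply: integrable_oppr; exact: Vi.
- by apply: filterS VT => w /= ->.
move=> t tT; have ht := filtration_sub hF (ltnW tT).
move: (Vrec _ tT) (le_condexpN ht (Vi _ tT)); apply: filterS2 => w /= -> EN.
set E := condexp P (F t) (V t.+1) w in EN *.
rewrite -!oppr_min -!oppr_max.
set L := Num.min (X t w) (Z t w); set U := Num.max (Y t w) (Z t w).
have LU : L <= U by rewrite /L /U ge_min !le_max lexx !orbT.
rewrite le_min; apply/andP; split.
  by rewrite lerN2 le_min LU le_max lexx.
rewrite oppr_min [- Num.max L E]oppr_max.
apply: le_trans (_ : Num.max (- U) (- E) <= _).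
  by rewrite ge_max !le_max !ge_min !lexx !orbT.
by rewrite ge_max !le_max lexx EN !orbT.
Qed.

End recursion.

Theorem theorem2p16 (d : measure_display) (Omega : measurableType d)
    (R : realType) (P : probability Omega R) (T : nat)
    (F : nat -> set (set Omega)) (X Y Z V : nat -> Omega -> R)
    (hF : filtration T F)
    (Xad : adapted T F X) (Yad : adapted T F Y) (Zad : adapted T F Z)
    (Xint : integrable_process P T X) (Yint : integrable_process P T Y)
    (Zint : integrable_process P T Z)
    (XYZ_T : \forall w \ae P, X T w = Y T w /\ Y T w = Z T w)
    (hV : dynkin_recursion P T F X Y Z V) :
  (forall t, (t <= T)%N -> \forall w \ae P,
     Num.min (X t w) (Y t w) <= V t w <= Num.max (X t w) (Y t w)) <->
  (forall t, (t <= T)%N ->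
     exists tau sigma : Omega -> nat, nash_equilibrium P T F X Y Z t tau sigma).
Proof.
have Vsub := dynkin_recursion_subsolution hF Xint Yint Zint hV.
have Vdual := dynkin_recursion_dual_subsolution hF Xint Yint Zint hV.
have Vint := dynkin_recursion_integrable hF Xint Yint Zint hV.
have Nad (W : nat -> Omega -> R) : adapted T F W -> adapted T F (fun t => \- W t).
  by move=> Wad t tT; apply: measurable_wrtN; exact: Wad.
have Nint W : integrable_process P T W -> integrable_process P T (fun t => \- W t).
  by move=> Wint t tT; apply: integrable_oppr; exact: Wint.
split=> [VXY|nash] t tT.
  have ht := filtration_sub hF tT.
  have [|ts hts tsV] := subsolution_guarantee hF Xad Zad Xint Yint Zint Vsub tT.
    by move=> s /andP[_ /VXY]; apply: filterS => w /andP[].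
  have [|ss hss ssV] := subsolution_guarantee hF (Nad _ Yad) (Nad _ Zad)
      (Nint _ Yint) (Nint _ Xint) (Nint _ Zint) Vdual tT.
    move=> s /andP[_ /VXY]; apply: filterS => w /andP[VXY' _] /=.
    by rewrite -oppr_min lerN2 minC.
  exists ts, ss; apply/nash_equilibriumP => //.
  have pi tau sigma : stopping_time T F t tau -> stopping_time T F t sigma ->
      P.-integrable setT (EFin \o payoff X Y Z tau sigma).
    exact: integrable_payoff.
  have {}ssV tau : stopping_time T F t tau ->
      integral_le_on P (F t) setT (payoff X Y Z tau ss) (V t).
    move=> htau; have := ssV _ htau; rewrite payoff_dual.
    move=> /(integral_le_onN ht (integrable_oppr (Vint _ tT))
      (integrable_oppr (pi _ _ htau hss))).
    by apply: integral_le_on_eq => w _ /=; rewrite opprK.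
  split=> // tau sigma htau hsigma; split.
    exact: integral_le_on_trans (ssV _ htau) (tsV _ hss).
  exact: integral_le_on_trans (ssV _ hts) (tsV _ hsigma).
have {}nash s (sT : (s <= T)%N) :
    exists tau sigma, integral_nash P T F X Y Z s tau sigma.
  have [ts [ss eqm]] := nash s sT; exists ts, ss.
  exact/nash_equilibriumP.
have upper := nash_subsolution_le hF Xad Yad Zad Xint Yint Zint Vsub.
have lower := nash_subsolution_le hF (Nad _ Yad) (Nad _ Xad) (Nad _ Zad)
  (Nint _ Yint) (Nint _ Xint) (Nint _ Zint) Vdual.
have {}upper : \forall w \ae P, V t w <= Num.max (X t w) (Y t w).
  apply: upper => //; apply: filterS XYZ_T => w [-> ->].
  by rewrite le_max lexx.
have {}lower : \forall w \ae P, - V t w <= Num.max (- Y t w) (- X t w).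
  apply: lower => // [|s sT].
    by apply: filterS XYZ_T => w /= [-> ->] /=; rewrite le_max lexx.
  have [ts [ss eqm]] := nash s sT; exists ss, ts.
  exact: integral_nash_dual.
move: upper lower; apply: filterS2 => w ->.
by rewrite -oppr_min lerN2 minC => ->.
Qed.
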